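(* For every $c\in\mathbb{R}$ there exists a dark soliton with profile $U_c\in\mathcal{F}\cap C^\infty(\mathbb{R})$, $U_c:\mathbb{R}\to\mathbb{C}$, satisfying $$U_c''-2ic(1-|U_c|^2)U_c'+2(1-|U_c|^2)U_c=0$$ on $\mathbb{R}$ and the boundary conditions $U_c(\xi)\to e^{i\theta_\pm(c)}$ as $\xi\to\pm\infty$ for some phases $\theta_\pm(c)\in[0,2\pi)$. The family $(U_c)_{c\in\mathbb{R}}$ is such that the mapping $c\mapsto U_c$ is $C^\infty$ on $\mathbb{R}\setminus\{0\}$ (the profile $U_c(\xi)$ depends smoothly on $c$) and $$\|U_c-\varphi\|_{\mathcal{H}^2_-}\to0\quad\text{as } c\to0.$$
   Context: $\varphi(\xi)=\tanh(\xi)$ is the black soliton, which is the profile $U_c$ for $c=0$. The set $\mathcal{F}$ is $\mathcal{F}=\{f\in L^\infty(\mathbb{R}): |f(x)|<1 \text{ for } x\in\mathbb{R},\ |f(x)|\to1 \text{ as } |x|\to\infty\}$ (complex-valued functions). $\mathcal{H}=\{f\in L^2_{\rm loc}(\mathbb{R}):\sqrt{1-\varphi^2}f\in L^2(\mathbb{R})\}$ with norm $\|f\|_{\mathcal{H}}^2=\int_{\mathbb{R}}(1-\varphi^2)|f|^2dx$, where $1-\varphi^2=\mathrm{sech}^2$. $\mathcal{H}^2_-=\{f\in\mathcal{H}: f'\in L^2(\mathbb{R}),\ \cosh(\cdot)f''\in L^2(\mathbb{R})\}$ with norm $\|f\|_{\mathcal{H}^2_-}=\sqrt{\|\cosh(\cdot)f''\|_{L^2}^2+\|f'\|_{L^2}^2+\|f\|_{\mathcal{H}}^2}$.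 (The profile gives the traveling wave $\psi(t,x)=e^{-2it}U_c(x-2ct)$ of $i(1-|\psi|^2)\psi_t+\psi_{xx}=0$.) *)

(* Defs.v *)
From HB Require Import structures.
From mathcomp Require Import all_boot all_order all_algebra.
From mathcomp Require Import complex.
From mathcomp Require Import all_classical all_reals all_analysis.

Set Implicit Arguments.
Unset Strict Implicit.
Unset Printing Implicit Defensive.

Import Order.TTheory GRing.Theory Num.Theory.
Import numFieldNormedType.Exports.

Local Open Scope classical_set_scope.
Local Open Scope complex_scope.
Local Open Scope ring_scope.

(* R[i] carries no normed-module structure over R in the library, so the      *)
(* calculus of complex-valued functions of real variables is componentwise.   *)

Notation normc := ComplexField.Normc.normc.

Definition cis {R : realType} (t : R) : R[i] := cos t +i* sin t.

Definition cderive {R : realType} (f : R -> R[i]) (x : R) : R[i] :=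
  derive1 (fun y => complex.Re (f y)) x +i* derive1 (fun y => complex.Im (f y)) x.

(* C^n on an open subset D of a finite-dimensional space: all iterated        *)
(* directional derivatives up to order n exist and are continuous on D.       *)
Fixpoint class_C {R : realType} {V : normedModType R} (n : nat) (D : set V)
    (f : V -> R) : Prop :=
  (forall x, D x -> {for x, continuous f}) /\
  match n with
  | 0 => True
  | m.+1 => forall v : V,
      (forall x, D x -> derivable f x v) /\ class_C m D ('D_v f)
  end.

Definition smooth {R : realType} {V : normedModType R} (D : set V)
    (f : V -> R[i]) : Prop :=
  forall n, class_C n D (fun x => complex.Re (f x)) /\
            class_C n D (fun x => complex.Im (f x)).

Definition cmeasurable {R : realType} (f : R -> R[i]) : Prop :=
  measurable_fun setT (fun x => complex.Re (f x)) /\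
  measurable_fun setT (fun x => complex.Im (f x)).

Definition Lpnorm {R : realType} (p : \bar R) (f : R -> R[i]) : \bar R :=
  Lnorm (@lebesgue_measure R) p (fun x => (normc (f x))%:E).

Definition in_Lp {R : realType} (p : \bar R) (f : R -> R[i]) : Prop :=
  cmeasurable f /\ (Lpnorm p f < +oo)%E.

Definition in_L2loc {R : realType} (f : R -> R[i]) : Prop :=
  cmeasurable f /\
  forall K : set R, compact K ->
    (\int[@lebesgue_measure R]_(x in K) (normc (f x) ^+ 2)%:E < +oo)%E.

Definition cosh {R : realType} (x : R) : R := (expR x + expR (- x)) / 2.
Definition sinh {R : realType} (x : R) : R := (expR x - expR (- x)) / 2.
Definition tanh {R : realType} (x : R) : R := sinh x / cosh x.

Definition black_soliton {R : realType} (x : R) : R[i] := (tanh x)%:C.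

Definition in_F {R : realType} (f : R -> R[i]) : Prop :=
  [/\ in_Lp +oo%E f,
      forall x, normc (f x) < 1,
      normc (f x) @[x --> +oo%R] --> (1 : R)
    & normc (f x) @[x --> -oo%R] --> (1 : R)].

Definition in_H {R : realType} (f : R -> R[i]) : Prop :=
  in_L2loc f /\
  in_Lp 2%:E (fun x => (Num.sqrt (1 - tanh x ^+ 2))%:C * f x).

Definition H_norm {R : realType} (f : R -> R[i]) : \bar R :=
  sqrte (\int[@lebesgue_measure R]_x
           ((1 - tanh x ^+ 2) * normc (f x) ^+ 2)%:E)%E.

(* A function of L^2_loc whose first two weak derivatives are locally         *)
(* integrable has a unique C^1 representative with locally absolutely         *)
(* continuous derivative, and its weak derivatives are then the (almost       *)
(* everywhere) pointwise ones. in_Hm2 is the space of these representatives;  *)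
(* its third and last clauses state the regularity of f and of f'.            *)
Definition in_Hm2 {R : realType} (f : R -> R[i]) : Prop :=
  let f' := cderive f in
  let f'' := cderive f' in
  [/\ in_H f,
      in_Lp 2%:E f' /\ in_Lp 2%:E (fun x => (cosh x)%:C * f'' x),
      forall x, derivable (fun y => complex.Re (f y)) x 1 /\
                derivable (fun y => complex.Im (f y)) x 1
    & forall a b : R, a <= b ->
        (\int[@lebesgue_measure R]_(x in `[a, b]) (complex.Re (f'' x))%:E =
           (complex.Re (f' b) - complex.Re (f' a))%:E)%E /\
        (\int[@lebesgue_measure R]_(x in `[a, b]) (complex.Im (f'' x))%:E =
           (complex.Im (f' b) - complex.Im (f' a))%:E)%E].

Definition Hm2_norm {R : realType} (f : R -> R[i]) : \bar R :=
  sqrte (Lpnorm 2%:E (fun x => (cosh x)%:C * cderive (cderive f) x)%R ^+ 2 +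
         Lpnorm 2%:E (cderive f) ^+ 2 + H_norm f ^+ 2)%E.

Definition profile_eq {R : realType} (c : R) (u : R -> R[i]) : Prop :=
  forall x : R,
    let eta := (1 - normc (u x) ^+ 2)%:C in
    cderive (cderive u) x - 2 * 'i%C * c%:C * eta * cderive u x
      + 2 * eta * u x = 0.

Definition cvg_phase {R : realType} (u : R -> R[i]) (F : set_system R)
    (t : R) : Prop :=
  [/\ 0 <= t, t < 2 * pi & normc (u x - cis t) @[x --> F] --> (0 : R)].

(* Main.v *)
Require Import Defs.
From HB Require Import structures.
From mathcomp Require Import all_boot all_order all_algebra.
From mathcomp Require Import complex.
From mathcomp Require Import all_classical all_reals all_analysis.
From mathcomp Require Import measurable_realfun ess_sup_inf.
From mathcomp Require Import ring lra.

Set Implicit Arguments.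
Unset Strict Implicit.
Unset Printing Implicit Defensive.

Import Order.TTheory GRing.Theory Num.Theory.
Import numFieldNormedType.Exports.

Local Open Scope classical_set_scope.
Local Open Scope complex_scope.
Local Open Scope ring_scope.

(** The dark solitons are explicit.  Writing T = tanh x and
    k = c / (1 + sqrt (1 + c^2)), so that |k| < 1 and c (1 - k^2) = 2 k, set
      U_c(x) = (T + i k) / (1 - i k T).
    This formula comes from the first integrals of the equation.  With
    eta = 1 - |U|^2, the conservation laws Im (conj U U') = - (c/2) eta^2 and
    |U'|^2 = eta^2, whose constants are fixed at infinity, show that in the
    arclength ds = eta dx the curve U has unit speed and constant curvature c,
    and that it meets the unit circle orthogonally: U_c runs along a geodesic of
    the Poincare disk, which is the image of the diameter (-1, 1) under a Moebius
    automorphism of the disk, and the parametrization of the diameter is by tanh,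
    as for c = 0.

    Everything then reduces to rational functions of (k, T), since
    T' = 1 - T^2 = sech^2 x:
    - 1 - |U_c|^2 = (1 - k^2)(1 - T^2) / (1 + k^2 T^2) is positive and tends
      to 0 as T tends to 1 or -1 ([modulus_profile], [soliton_at_infinity]);
    - the equation is a pair of rational identities ([profile_re],
      [profile_im]);
    - smoothness in (c, x) jointly follows from closure of iterated directional
      differentiability under the operations of the formula
      ([smooth_soliton_family]);
    - U_c - tanh, its first derivative, and cosh times its second derivative
      have squared moduli at most a constant times k^2 times, respectively,
      1, sech^2 and sech^2 ([re0_im0_near], [re1_im1_near], [re2_im2_near]).
      As the integral of sech^2 is 2, the norm of U_c - tanh in H^2_- is at most
      60 |c| ([Hm2_norm_soliton_le]), hence tends to 0 with c. *)

(** * Smooth functions are closed under the elementary operations *)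

(** Restricting [f] to the line through [x] in the direction [v] reduces the
    directional chain rule to the one for functions of one variable. *)
Lemma is_derive_comp1 (R : realType) (V : normedModType R) (h : R -> R)
    (f : V -> R) (x v : V) (a b : R) :
  is_derive (f x) 1 h a -> is_derive x v f b -> is_derive x v (h \o f) (a * b).
Proof.
move=> dh [df fE].
pose phi (t : R) := f (t *: v + x).
have phi0 : phi 0 = f x by rewrite /phi scale0r add0r.
have dE (g : V -> R) : 'D_1 (fun t : R => g (t *: v + x)) 0 = 'D_v g x.
  rewrite /derive; set g1 := fun t => t^-1 *: _; set g2 := fun t => t^-1 *: _.
  suff -> : g1 = g2 by []; apply/funext => t; rewrite /g1 /g2 /=.
  by rewrite addr0 scale0r add0r [_%:A]mulr1.
have dphi : is_derive (0 : R) 1 phi b.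
  by constructor; [exact: (derivable1P f x v).1 | rewrite dE].
rewrite -phi0 in dh.
have [d e] := is_derive1_comp dh dphi.
by constructor; [exact: (derivable1P (h \o f) x v).2 | rewrite -dE].
Qed.

Section class_C_closure.
Context {R : realType} {V : normedModType R}.
Implicit Types (f g : V -> R) (n : nat).

Definition smooth_fun f := forall n, class_C n [set: V] f.

Lemma class_C_continuous n f : class_C n [set: V] f -> continuous f.
Proof. by case: n => [|n] [cf _] x; exact: cf. Qed.

Lemma class_CS n f :
  continuous f ->
  (forall v, exists2 df : V -> R, (forall x, is_derive x v f (df x)) &
     class_C n [set: V] df) ->
  class_C n.+1 [set: V] f.
Proof.
move=> cf df; split=> [x _|v]; first exact: cf.
have [g gE Cg] := df v; split=> [x _|]; first by case: (gE x).
by rewrite (_ : 'D_v f = g)//; apply/funext => x; case: (gE x).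
Qed.

Lemma class_C_derive n f v : class_C n.+1 [set: V] f ->
  (forall x, is_derive x v f ('D_v f x)) /\ class_C n [set: V] ('D_v f).
Proof.
by move=> [_ /(_ v)[df Cf]]; split=> // x; constructor=> //; exact: df.
Qed.

(** Needed by the product rule, where undifferentiated factors reappear. *)
Lemma class_CW n f : class_C n.+1 [set: V] f -> class_C n [set: V] f.
Proof.
elim: n f => [|n IHn] f Cf; first by split=> // x _; apply: class_C_continuous Cf x.
apply: class_CS => [|v]; first exact: class_C_continuous Cf.
by have [df Cdf] := class_C_derive v Cf; exists ('D_v f) => //; exact: IHn.
Qed.

Lemma class_C_cst n (r : R) : class_C n [set: V] (fun=> r).
Proof.
elim: n r => [|n IHn] r; first by split=> // x _; exact: cvg_cst.
apply: class_CS => [x|v]; first exact: cvg_cst.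
by exists (fun=> 0) => // x; exact: is_derive_cst.
Qed.

Lemma class_CD n f g : class_C n [set: V] f -> class_C n [set: V] g ->
  class_C n [set: V] (fun x => f x + g x).
Proof.
elim: n f g => [|n IHn] f g Cf Cg.
  split=> // x _; apply: continuousD.
    exact: class_C_continuous Cf x.
  exact: class_C_continuous Cg x.
apply: class_CS => [x|v].
  by apply: continuousD; [exact: class_C_continuous Cf x|exact: class_C_continuous Cg x].
have [df Cdf] := class_C_derive v Cf; have [dg Cdg] := class_C_derive v Cg.
by exists (fun x => 'D_v f x + 'D_v g x) => [x|]; [exact: is_deriveD|exact: IHn].
Qed.

Lemma class_CM n f g : class_C n [set: V] f -> class_C n [set: V] g ->
  class_C n [set: V] (fun x => f x * g x).
Proof.
elim: n f g => [|n IHn] f g Cf Cg.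
  split=> // x _; apply: continuousM.
    exact: class_C_continuous Cf x.
  exact: class_C_continuous Cg x.
apply: class_CS => [x|v].
  by apply: continuousM; [exact: class_C_continuous Cf x|exact: class_C_continuous Cg x].
have [df Cdf] := class_C_derive v Cf; have [dg Cdg] := class_C_derive v Cg.
exists (fun x => f x * 'D_v g x + g x * 'D_v f x) => [x|]; first exact: is_deriveM.
by apply: class_CD; apply: IHn => //; exact: class_CW.
Qed.

(** Smoothness of [h \o f] bootstraps when the derivative of [h] can be computed
    from [h] by smooth operations, as for the inverse, the exponential and the
    square root: [step] is this computation, and gains one order at a time. *)
Lemma smooth_comp (h dh : R -> R) f :
  smooth_fun f -> (forall x, is_derive (f x) 1 h (dh (f x))) ->
  (forall n, class_C n [set: V] (h \o f) -> class_C n [set: V] (dh \o f)) ->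
  smooth_fun (h \o f).
Proof.
move=> Cf hE step.
have ch : continuous (h \o f).
  move=> x; apply: continuous_comp; first exact: class_C_continuous (Cf 0) x.
  by apply/differentiable_continuous/derivable1_diffP; case: (hE x).
elim=> [|n IHn]; first by split=> // x _; exact: ch.
apply: class_CS => // v; have [df Cdf] := class_C_derive v (Cf n.+1).
exists (fun x => dh (f x) * 'D_v f x) => [x|]; first exact: is_derive_comp1.
by apply: class_CM => //; exact: step.
Qed.

Lemma smooth_continuous f : smooth_fun f -> continuous f.
Proof. by move=> Cf; exact: class_C_continuous (Cf 0). Qed.

Lemma smooth_cst (r : R) : smooth_fun (fun=> r).
Proof. by move=> n; exact: class_C_cst. Qed.

Lemma smoothD f g : smooth_fun f -> smooth_fun g -> smooth_fun (fun x => f x + g x).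
Proof. by move=> Cf Cg n; exact: class_CD. Qed.

Lemma smoothM f g : smooth_fun f -> smooth_fun g -> smooth_fun (fun x => f x * g x).
Proof. by move=> Cf Cg n; exact: class_CM. Qed.

Lemma smoothX f n : smooth_fun f -> smooth_fun (fun x => f x ^+ n).
Proof.
move=> Cf; elim: n => [|n IHn]; first exact: smooth_cst.
by under eq_fun do rewrite exprS; exact: smoothM.
Qed.

Lemma smoothN f : smooth_fun f -> smooth_fun (fun x => - f x).
Proof.
move=> Cf; rewrite (_ : (fun x => - f x) = fun x => (-1) * f x).
  exact: smoothM (smooth_cst _) Cf.
by apply/funext => x; rewrite mulN1r.
Qed.

Lemma smoothV f : (forall x, f x != 0) -> smooth_fun f -> smooth_fun (fun x => (f x)^-1).
Proof.
move=> f0 Cf; apply: (@smooth_comp GRing.inv (fun y => - (y^-1 * y^-1)) f) => // [x|n Cn].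
  apply: is_derive_eq; first exact: (@is_deriveV _ id (f x) 1 1 (f0 x)).
  by rewrite [_ *: _]mulr1 expr2 invfM.
rewrite (_ : _ \o f = fun x => (-1) * ((f x)^-1 * (f x)^-1)).
  by apply: class_CM; [exact: class_C_cst|exact: class_CM].
by apply/funext => x /=; rewrite mulN1r.
Qed.

Lemma smooth_expR f : smooth_fun f -> smooth_fun (fun x => expR (f x)).
Proof. by move=> Cf; exact: (@smooth_comp expR expR f). Qed.

Lemma smooth_sqrt f : (forall x, 0 < f x) -> smooth_fun f ->
  smooth_fun (fun x => Num.sqrt (f x)).
Proof.
move=> f0 Cf.
apply: (@smooth_comp Num.sqrt (fun y => Num.sqrt y / (2 * y)) f) => // [x|n Cn].
  apply: is_derive_eq; first exact: is_derive1_sqrt.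
  have s0 : Num.sqrt (f x) != 0 by rewrite gt_eqF// sqrtr_gt0.
  by rewrite -[X in _ / (2 * X)]sqr_sqrtr ?ltW//; field.
apply: class_CM => //; apply: smoothV => [x|]; first by rewrite mulf_neq0// gt_eqF.
exact: smoothM (smooth_cst _) Cf.
Qed.

Lemma smooth_linear (l : {linear V -> R}) : continuous l -> smooth_fun l.
Proof.
move=> cl [|n]; first by split=> // x _; exact: cl.
apply: class_CS => // v; exists (fun=> l v) => [x|]; last exact: class_C_cst.
have dl : differentiable l x by exact: linear_differentiable.
by constructor; [exact: diff_derivable|rewrite deriveE// diff_lin].
Qed.

Lemma smooth_tanh f : smooth_fun f -> smooth_fun (fun x => tanh (f x)).
Proof.
move=> Cf; have CNf := smoothN Cf.
have half : smooth_fun (fun=> 2^-1) by exact: smooth_cst.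
apply: smoothM.
  by apply: smoothM half; apply: smoothD; [|apply: smoothN]; exact: smooth_expR.
apply: smoothV => [x|].
  by rewrite gt_eqF// divr_gt0// addr_gt0// expR_gt0.
by apply: smoothM half; apply: smoothD; exact: smooth_expR.
Qed.

End class_C_closure.

Lemma smooth_id (R : realType) : smooth_fun (fun x : R => x).
Proof. exact: (@smooth_linear R R idfun (fun x => cvg_id)). Qed.

Lemma smooth_fst (R : realType) : smooth_fun (fun p : R * R => p.1).
Proof. exact: (@smooth_linear R (R * R)%type fst (fun x => cvg_fst)). Qed.

Lemma smooth_snd (R : realType) : smooth_fun (fun p : R * R => p.2).
Proof. exact: (@smooth_linear R (R * R)%type snd (fun x => cvg_snd)). Qed.

Lemma class_C_sub (R : realType) (V : normedModType R) n (D : set V) (f : V -> R) :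
  class_C n [set: V] f -> class_C n D f.
Proof.
elim: n f => [|n IHn] f [cf df]; first by split=> // x _; exact: cf.
split=> [x _|v]; first exact: cf.
by have [dfv Cdf] := df v; split; [move=> x _; exact: dfv|exact: IHn].
Qed.

(** * Derivatives of rational functions of the hyperbolic tangent *)

(** The derivation rules for pointwise expressions: in this form the head
    symbol of the function drives the choice of the rule in [prove_derive]
    below, which leaves the derivative to be found by unification. *)
Section pointwise_derivatives.
Context {R : realType}.
Implicit Types (f g : R -> R) (x a b : R).

Lemma derD f g x a b : is_derive x 1 f a -> is_derive x 1 g b ->
  is_derive x 1 (fun y => f y + g y) (a + b).
Proof. exact: is_deriveD. Qed.

Lemma derM f g x a b : is_derive x 1 f a -> is_derive x 1 g b ->
  is_derive x 1 (fun y => f y * g y) (f x * b + g x * a).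
Proof. exact: is_deriveM. Qed.

Lemma derN f x a : is_derive x 1 f a -> is_derive x 1 (fun y => - f y) (- a).
Proof. exact: is_deriveN. Qed.

Lemma derV f x a : f x != 0 -> is_derive x 1 f a ->
  is_derive x 1 (fun y => (f y)^-1) (- (a / f x ^+ 2)).
Proof.
move=> f0 df; notypeclasses refine (is_derive_eq _ _);
  first exact: (@is_deriveV _ f x a 1 f0 df).
by rewrite [_ *: _]mulNr mulrC.
Qed.

Lemma derX f x a n : is_derive x 1 f a ->
  is_derive x 1 (fun y => f y ^+ n) (n%:R * f x ^+ n.-1 * a).
Proof.
move=> df; rewrite (_ : (fun y => f y ^+ n) = f ^+ n); first exact: is_deriveX.
by apply/funext => y; rewrite exprfctE.
Qed.

Lemma der_cst x a : is_derive x 1 (fun _ : R => a) 0.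
Proof. exact: is_derive_cst. Qed.

Lemma der_id x : is_derive x 1 (fun y : R => y) 1.
Proof. exact: is_derive_id. Qed.

End pointwise_derivatives.

(* Type class resolution is kept out of these steps: the instances would give the
   derivative in the vocabulary of the pointwise ring structure on functions. *)
Ltac prove_derive := repeat first
  [ notypeclasses refine (der_cst _ _) | notypeclasses refine (der_id _)
  | notypeclasses refine (is_derive_expR _) | notypeclasses refine (derD _ _)
  | notypeclasses refine (derN _) | notypeclasses refine (derX _ _)
  | notypeclasses refine (derM _ _) | notypeclasses refine (derV _ _)
  | eassumption ].

Section hyperbolic_tangent.
Context {R : realType}.
Implicit Types x : R.

Lemma cosh_gt0 x : 0 < cosh x.
Proof. by rewrite divr_gt0// addr_gt0// expR_gt0. Qed.

Lemma cosh2B_sinh2 x : cosh x ^+ 2 - sinh x ^+ 2 = 1.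
Proof.
have : expR x * expR (- x) = 1 by rewrite expRN divff// gt_eqF// expR_gt0.
rewrite /cosh /sinh; move: (expR x) (expR (- x)) => u v uv.
by rewrite -[RHS]uv; field.
Qed.

Lemma sech2E x : 1 - tanh x ^+ 2 = (cosh x ^+ 2)^-1.
Proof.
have c0 : cosh x != 0 by rewrite gt_eqF// cosh_gt0.
by rewrite -[RHS]mul1r -[X in _ = X * _](cosh2B_sinh2 x) /tanh; field.
Qed.

Lemma sech2_gt0 x : 0 < 1 - tanh x ^+ 2.
Proof. by rewrite sech2E invr_gt0 exprn_gt0// cosh_gt0. Qed.

Lemma der_expRN x : is_derive x 1 (fun y : R => expR (- y)) (- expR (- x)).
Proof.
notypeclasses refine (is_derive_eq _ _);
  first exact: (is_derive1_comp (is_derive_expR _) (derN (der_id x))).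
by rewrite mulrN1.
Qed.

Lemma der_tanh x : is_derive x 1 tanh (1 - tanh x ^+ 2).
Proof.
have c0 : cosh x != 0 by rewrite gt_eqF// cosh_gt0.
have dN := der_expRN x.
have ds : is_derive x 1 sinh (cosh x).
  notypeclasses refine (is_derive_eq _ _); first by rewrite /sinh; prove_derive.
  by rewrite /cosh /=; field.
have dc : is_derive x 1 cosh (sinh x).
  notypeclasses refine (is_derive_eq _ _); first by rewrite /cosh; prove_derive.
  by rewrite /sinh /=; field.
have dt := derM ds (@derV R cosh x _ c0 dc).
notypeclasses refine (@is_derive_eq _ _ _ tanh x 1 _ _ dt _).
by rewrite /tanh; field.
Qed.

Lemma tanhN x : tanh (- x) = - tanh x.
Proof.
rewrite /tanh /sinh /cosh opprK [expR (- x) + expR x]addrC.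
by rewrite -[RHS]mulNr -[in RHS]mulNr opprB.
Qed.

Lemma tanh_sqr_le1 x : tanh x ^+ 2 <= 1.
Proof. by rewrite -subr_ge0 ltW// sech2_gt0. Qed.

Lemma cvg_tanh_pinfty : tanh x @[x --> +oo] --> (1 : R).
Proof.
have -> : tanh = fun x : R =>
    (1 - expR (- x) * expR (- x)) / (1 + expR (- x) * expR (- x)).
  apply/funext => x; rewrite /tanh /sinh /cosh expRN.
  move: (expR x) (expR_gt0 x) => u u0.
  have [h1 h2] : u != 0 /\ 1 + u * u != 0.
    by split; rewrite gt_eqF// addr_gt0// mulr_gt0.
  by field; rewrite h1 addrC h2.
have e2 : expR (- x) * expR (- x) @[x --> +oo] --> (0 : R).
  by rewrite -[X in _ --> X](mul0r 0); apply: cvgM; exact: cvgr_expR.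
(* tanh x = q (exp (- 2 x)), and q is continuous at 0 with value 1 *)
pose q (u : R) : R := (1 - u) / (1 + u).
have q0 : q 0 = 1 by rewrite /q subr0 addr0 divr1.
have cq : {for 0, continuous q}.
  apply/differentiable_continuous/derivable1_diffP.
  suff [d []] : exists d, is_derive (0 : R) 1 q d by [].
  by eexists; rewrite /q; prove_derive; rewrite addr0.
have := continuous_cvg _ cq e2; rewrite q0; apply.
Qed.

End hyperbolic_tangent.

Section profile_in_tanh.
Context {R : realType}.
Implicit Types (k t x : R).

(** With t = tanh x, [re0] and [im0] are the real and imaginary parts of
    (t + i k) / (1 - i k t), [denom] being |1 - i k t|^2.  The functions with
    indices 1 and 2 are the first and second derivatives with respect to x, that
    is, they are obtained by applying (1 - t^2) d/dt. *)
Definition denom k t := 1 + k ^+ 2 * t ^+ 2.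

Definition re0 k t := (1 - k ^+ 2) * t / denom k t.
Definition im0 k t := k * (1 + t ^+ 2) / denom k t.
Definition re1 k t :=
  (1 - k ^+ 2) * (1 - t ^+ 2) * (1 - k ^+ 2 * t ^+ 2) / denom k t ^+ 2.
Definition im1 k t :=
  2 * k * (1 - k ^+ 2) * t * (1 - t ^+ 2) / denom k t ^+ 2.
Definition re2 k t :=
  - 2 * (1 - k ^+ 2) * (1 - t ^+ 2) * t *
  ((1 + k ^+ 2) * (1 - k ^+ 2 * t ^+ 2) + 2 * k ^+ 2 * (1 - t ^+ 2)) /
  denom k t ^+ 3.
Definition im2 k t :=
  - 2 * (1 - k ^+ 2) * (1 - t ^+ 2) * k *
  (2 * (1 + k ^+ 2) * t ^+ 2 - (1 - t ^+ 2) * (1 - k ^+ 2 * t ^+ 2)) /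
  denom k t ^+ 3.

Lemma denom_ge1 k t : 1 <= denom k t.
Proof. by rewrite lerDl mulr_ge0// sqr_ge0. Qed.

Lemma denom_neq0 k t : denom k t != 0.
Proof. by rewrite gt_eqF// (lt_le_trans ltr01)// denom_ge1. Qed.

Lemma der_re0 k x :
  is_derive x 1 (fun y => re0 k (tanh y)) (re1 k (tanh x)).
Proof.
have d0 := denom_neq0 k (tanh x).
notypeclasses refine (is_derive_eq _ _).
  notypeclasses refine (@is_derive1_comp _ (re0 k) tanh x _ _ _ (der_tanh x)).
  rewrite /re0 /denom; prove_derive.
by move: d0; rewrite /re1 /denom /=; move: (tanh x) => t d0;
  field; rewrite exprMn.
Qed.

Lemma der_im0 k x :
  is_derive x 1 (fun y => im0 k (tanh y)) (im1 k (tanh x)).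
Proof.
have d0 := denom_neq0 k (tanh x).
notypeclasses refine (is_derive_eq _ _).
  notypeclasses refine (@is_derive1_comp _ (im0 k) tanh x _ _ _ (der_tanh x)).
  rewrite /im0 /denom; prove_derive.
by move: d0; rewrite /im1 /denom /=; move: (tanh x) => t d0;
  field; rewrite exprMn.
Qed.

Lemma der_re1 k x :
  is_derive x 1 (fun y => re1 k (tanh y)) (re2 k (tanh x)).
Proof.
have d0 := denom_neq0 k (tanh x).
have d2 : denom k (tanh x) ^+ 2 != 0 by rewrite expf_neq0.
notypeclasses refine (is_derive_eq _ _).
  notypeclasses refine (@is_derive1_comp _ (re1 k) tanh x _ _ _ (der_tanh x)).
  rewrite /re1 /denom; prove_derive.
clear d2; by move: d0; rewrite /re2 /denom /=; move: (tanh x) => t d0;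
  field; rewrite exprMn.
Qed.

Lemma der_im1 k x :
  is_derive x 1 (fun y => im1 k (tanh y)) (im2 k (tanh x)).
Proof.
have d0 := denom_neq0 k (tanh x).
have d2 : denom k (tanh x) ^+ 2 != 0 by rewrite expf_neq0.
notypeclasses refine (is_derive_eq _ _).
  notypeclasses refine (@is_derive1_comp _ (im1 k) tanh x _ _ _ (der_tanh x)).
  rewrite /im1 /denom; prove_derive.
clear d2; by move: d0; rewrite /im2 /denom /=; move: (tanh x) => t d0;
  field; rewrite exprMn.
Qed.

Lemma modulus_profile k t :
  1 - (re0 k t ^+ 2 + im0 k t ^+ 2) = (1 - k ^+ 2) * (1 - t ^+ 2) / denom k t.
Proof.
by have := denom_neq0 k t; rewrite /re0 /im0 /denom => d0;
  field; rewrite exprMn.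
Qed.

(** Clearing the denominators and replacing c (1 - k^2) by 2 k turns the real
    and imaginary parts of the equation into polynomial identities. *)
Lemma profile_re c k t : c * (1 - k ^+ 2) = 2 * k ->
  let eta := 1 - (re0 k t ^+ 2 + im0 k t ^+ 2) in
  re2 k t + 2 * c * eta * im1 k t + 2 * eta * re0 k t = 0.
Proof.
move=> ck eta; rewrite /eta modulus_profile.
have := denom_neq0 k t; rewrite /re0 /re2 /im1 => d0.
transitivity (2 * (1 - k ^+ 2) * (1 - t ^+ 2) * t / denom k t ^+ 3 *
  (- ((1 + k ^+ 2) * (1 - k ^+ 2 * t ^+ 2) + 2 * k ^+ 2 * (1 - t ^+ 2)) +
   2 * k * (c * (1 - k ^+ 2)) * (1 - t ^+ 2) + (1 - k ^+ 2) * denom k t)).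
  by field.
by rewrite ck /denom; apply/eqP; rewrite mulf_eq0; apply/orP; right; apply/eqP; ring.
Qed.

Lemma profile_im c k t : c * (1 - k ^+ 2) = 2 * k ->
  let eta := 1 - (re0 k t ^+ 2 + im0 k t ^+ 2) in
  im2 k t - 2 * c * eta * re1 k t + 2 * eta * im0 k t = 0.
Proof.
move=> ck eta; rewrite /eta modulus_profile.
have := denom_neq0 k t; rewrite /im0 /im2 /re1 => d0.
transitivity (2 * (1 - k ^+ 2) * (1 - t ^+ 2) / denom k t ^+ 3 *
  (- k * (2 * (1 + k ^+ 2) * t ^+ 2 - (1 - t ^+ 2) * (1 - k ^+ 2 * t ^+ 2)) -
   (c * (1 - k ^+ 2)) * (1 - t ^+ 2) * (1 - k ^+ 2 * t ^+ 2) +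
   k * (1 + t ^+ 2) * denom k t)).
  by field.
by rewrite ck /denom; apply/eqP; rewrite mulf_eq0; apply/orP; right; apply/eqP; ring.
Qed.

End profile_in_tanh.

(** * Estimates of the profile near the black soliton *)

Section profile_estimates.
Context {R : realType}.
Implicit Types (k t c : R).

Lemma ler_pdiv y d M : 1 <= d -> 0 <= M -> y <= M -> y / d <= M :> R.
Proof.
move=> d1 M0 yM; rewrite ler_pdivrMr ?(lt_le_trans ltr01)//.
by rewrite (le_trans yM)// ler_peMr.
Qed.

(** U_c - tanh = i k (1 + t^2) / (1 - i k t) carries a factor k. *)
Lemma re0_im0_near k t : t ^+ 2 <= 1 ->
  (re0 k t - t) ^+ 2 + im0 k t ^+ 2 <= 4 * k ^+ 2.
Proof.
move=> t1; have d1 := denom_ge1 k t; have d0 := denom_neq0 k t.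
have -> : (re0 k t - t) ^+ 2 + im0 k t ^+ 2 =
    k ^+ 2 * ((1 + t ^+ 2) ^+ 2 / denom k t).
  by move: d0; rewrite /re0 /im0 /denom => d0; field; rewrite exprMn.
rewrite [4 * _]mulrC ler_wpM2l ?sqr_ge0//; apply: ler_pdiv => //.
have := sqr_ge0 t; move: (t ^+ 2) t1 => T T1 T0; nra.
Qed.

(** Both components are k (1 - t^2) times a function that is bounded on
    [-1, 1]^2; one of the two factors 1 - t^2 of the square is given up. *)
Lemma re1_im1_near k t : k ^+ 2 <= 1 -> t ^+ 2 <= 1 ->
  (re1 k t - (1 - t ^+ 2)) ^+ 2 + im1 k t ^+ 2 <= 20 * k ^+ 2 * (1 - t ^+ 2).
Proof.
move=> k1 t1; have d1 := denom_ge1 k t; have d0 := denom_neq0 k t.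
pose P := 1 + 3 * t ^+ 2 - k ^+ 2 * t ^+ 2 * (1 - t ^+ 2).
have -> : (re1 k t - (1 - t ^+ 2)) ^+ 2 + im1 k t ^+ 2 =
    k ^+ 2 * (1 - t ^+ 2) * ((1 - t ^+ 2) *
    (k ^+ 2 * P ^+ 2 + 4 * (1 - k ^+ 2) ^+ 2 * t ^+ 2) / denom k t ^+ 4).
  by move: d0; rewrite /P /re1 /im1 /denom => d0; field; rewrite exprMn.
rewrite (_ : 20 * _ * _ = k ^+ 2 * (1 - t ^+ 2) * 20); last by ring.
rewrite ler_wpM2l//.
  by rewrite mulr_ge0 ?sqr_ge0 ?subr_ge0.
apply: ler_pdiv => //; first by rewrite exprn_ege1.
rewrite {}/P; have := sqr_ge0 t; have := sqr_ge0 k.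
move: (t ^+ 2) (k ^+ 2) t1 k1 => T K T1 K1 K0 T0 {d1 d0}.
have KT : 0 <= K * T * (1 - T) <= 1.
  rewrite !mulr_ge0 ?subr_ge0//= mulr_ile1 ?mulr_ge0 ?subr_ge0 ?mulr_ile1//.
  by rewrite lerBlDr lerDl.
set P := 1 + 3 * T - K * T * (1 - T); have P4 : 0 <= P <= 4.
  by move: KT; rewrite /P; move: (K * T * (1 - T)) => W; lra.
have P16 : K * P ^+ 2 <= 16.
  have : P ^+ 2 <= 16 by move: (P) P4 => p; nra.
  have := sqr_ge0 P; move: (P ^+ 2) => Q; nra.
have Q4 : 4 * (1 - K) ^+ 2 * T <= 4.
  have : (1 - K) ^+ 2 <= 1 by nra.
  have := sqr_ge0 (1 - K); move: ((1 - K) ^+ 2) => Q; nra.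
have a0 : 0 <= K * P ^+ 2 by rewrite mulr_ge0 ?sqr_ge0.
have b0 : 0 <= 4 * (1 - K) ^+ 2 * T by rewrite mulr_ge0// mulr_ge0// sqr_ge0.
have T1' : 1 - T <= 1 by rewrite lerBlDr lerDl.
by rewrite (le_trans (ler_piMl (addr_ge0 a0 b0) T1'))//
  (le_trans (lerD P16 Q4))//; lra.
Qed.

(** As [re1_im1_near], but both factors 1 - t^2 = sech^2 x are kept: one of them
    compensates the weight cosh^2 x. *)
Lemma re2_im2_near k t : k ^+ 2 <= 1 -> t ^+ 2 <= 1 ->
  (re2 k t + 2 * t * (1 - t ^+ 2)) ^+ 2 + im2 k t ^+ 2 <=
  1664 * k ^+ 2 * (1 - t ^+ 2) ^+ 2.
Proof.
move=> k1 t1; have d1 := denom_ge1 k t; have d0 := denom_neq0 k t.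
(* P arises from (1 - K) (1 + 3 K - 3 K T - K^2 T) - denom^3 = K P, where
   K = k^2 and T = t^2. *)
pose P := 2 - 6 * t ^+ 2 - 3 * k ^+ 2 + 2 * (k ^+ 2 * t ^+ 2)
  - 3 * (k ^+ 2 * t ^+ 4) + k ^+ 4 * t ^+ 2 - k ^+ 4 * t ^+ 6.
pose Q := 2 * (1 + k ^+ 2) * t ^+ 2 - (1 - t ^+ 2) * (1 - k ^+ 2 * t ^+ 2).
have -> : (re2 k t + 2 * t * (1 - t ^+ 2)) ^+ 2 + im2 k t ^+ 2 =
    k ^+ 2 * (1 - t ^+ 2) ^+ 2 * (4 *
    (k ^+ 2 * t ^+ 2 * P ^+ 2 + (1 - k ^+ 2) ^+ 2 * Q ^+ 2) / denom k t ^+ 6).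
  by move: d0; rewrite /P /Q /re2 /im2 /denom => d0; field; rewrite exprMn.
rewrite (_ : 1664 * _ * _ = k ^+ 2 * (1 - t ^+ 2) ^+ 2 * 1664); last by ring.
rewrite ler_wpM2l//.
  by rewrite mulr_ge0 ?sqr_ge0.
apply: ler_pdiv; [by rewrite exprn_ege1|exact: ler0n|].
have k0 := sqr_ge0 k; have t0 := sqr_ge0 t.
have kt i j : 0 <= (k ^+ 2) ^+ i * (t ^+ 2) ^+ j <= 1.
  have pow01 (y : R) n : 0 <= y -> y <= 1 -> 0 <= y ^+ n <= 1.
    by move=> y0 y1; rewrite exprn_ge0//= exprn_ile1.
  have /andP[a0 a1] := pow01 _ i k0 k1; have /andP[b0 b1] := pow01 _ j t0 t1.
  by rewrite mulr_ge0//= mulr_ile1.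
have P400 : P ^+ 2 <= 400.
  have : -20 <= P <= 20.
    move: (kt 1%N 1%N) (kt 1%N 2%N) (kt 2%N 1%N) (kt 2%N 3%N).
    by rewrite /P -[4%N]/(2 * 2)%N -[6%N]/(2 * 3)%N !exprM !expr1; lra.
  by move: (P) => p; nra.
have Q16 : Q ^+ 2 <= 16.
  have /andP[] := kt 1%N 1%N; have /andP[] := kt 1%N 2%N; rewrite !expr1.
  rewrite /Q; move: (t ^+ 2) (k ^+ 2) t1 k1 k0 t0 => T K T1 K1 K0 T0 *.
  have : -1 <= 2 * (1 + K) * T - (1 - T) * (1 - K * T) <= 4 by apply/andP; split; nra.
  by move: (_ - _ : R) => q; nra.
have /andP[] := kt 1%N 1%N; rewrite !expr1.
have : (1 - k ^+ 2) ^+ 2 <= 1 by move: (k ^+ 2) k0 k1 => K; nra.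
have := sqr_ge0 (1 - k ^+ 2); have := sqr_ge0 P; have := sqr_ge0 Q.
move: (P ^+ 2) (Q ^+ 2) ((1 - k ^+ 2) ^+ 2) (k ^+ 2 * t ^+ 2) P400 Q16.
by move=> p q a b ? ? ? ? ? ? ? ?; nra.
Qed.

(** The root in (-1, 1) of c (1 - k^2) = 2 k, with the denominator rationalized
    so that c = 0 is not a singular case. *)
Definition kappa c := c / (1 + Num.sqrt (1 + c ^+ 2)).

Lemma onePsqr_gt0 c : 0 < 1 + c ^+ 2.
Proof. by rewrite (lt_le_trans ltr01)// lerDl sqr_ge0. Qed.

Lemma kappa_denom_ge1 c : 1 <= 1 + Num.sqrt (1 + c ^+ 2).
Proof. by rewrite lerDl sqrtr_ge0. Qed.

Lemma kappa_denom_neq0 c : 1 + Num.sqrt (1 + c ^+ 2) != 0.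
Proof. by rewrite gt_eqF// (lt_le_trans ltr01)// kappa_denom_ge1. Qed.

Lemma onem_kappa2 c : 1 - kappa c ^+ 2 = 2 / (1 + Num.sqrt (1 + c ^+ 2)).
Proof.
have s2 : Num.sqrt (1 + c ^+ 2) ^+ 2 = 1 + c ^+ 2.
  by rewrite sqr_sqrtr// ltW// onePsqr_gt0.
have := kappa_denom_neq0 c; rewrite /kappa.
move: (Num.sqrt _) s2 => s s2 s0.
have c2 : c ^+ 2 = s ^+ 2 - 1 by rewrite s2; ring.
by rewrite expr_div_n c2; field.
Qed.

Lemma kappaE c : c * (1 - kappa c ^+ 2) = 2 * kappa c.
Proof. by rewrite onem_kappa2 /kappa; ring. Qed.

Lemma kappa_sqr_lt1 c : kappa c ^+ 2 < 1.
Proof.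
by rewrite -subr_gt0 onem_kappa2 divr_gt0// (lt_le_trans ltr01)// kappa_denom_ge1.
Qed.

Lemma kappa_sqr_le c : kappa c ^+ 2 <= c ^+ 2.
Proof.
rewrite /kappa expr_div_n ler_pdiv ?sqr_ge0//.
by rewrite exprn_ege1// kappa_denom_ge1.
Qed.

Lemma kappa0 : kappa 0 = 0.
Proof. by rewrite /kappa mul0r. Qed.

Lemma unit_circle_phase (a b : R) : a ^+ 2 + b ^+ 2 = 1 ->
  exists t : R, [/\ 0 <= t, t < 2 * pi, cos t = a & sin t = b].
Proof.
move=> ab1; have pi0 := pi_gt0 R.
have a1 : -1 <= a <= 1.
  by rewrite -ler_norml -(@expr_le1 _ 2)// real_normK ?num_real// -ab1 lerDl sqr_ge0.
have ca : cos (acos a) = a by rewrite acosK.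
have sa : sin (acos a) = `|b|.
  by rewrite sin_acos// -sqrtr_sqr; congr Num.sqrt; rewrite -ab1; ring.
(* acos covers the upper half circle; the lower half is its reflection *)
have [b0|b0] := leP 0 b.
  exists (acos a); split; rewrite ?acos_ge0 ?sa ?ger0_norm//.
  by rewrite (le_lt_trans (acos_lepi a1))//; lra.
exists (2 * pi - acos a); split.
- by have := acos_lepi a1; lra.
- have : 0 < acos a; last by lra.
  rewrite lt_neqAle acos_ge0// andbT; apply: contraTneq b0 => a0.
  by move: sa; rewrite -a0 sin0 => /esym/eqP; rewrite normr_eq0 => /eqP ->; rewrite ltxx.
- by rewrite addrC mulr_natl cosD2pi cosN.
- by rewrite addrC mulr_natl sinD2pi sinN sa ltr0_norm// opprK.
Qed.

End profile_estimates.

(** * Square integrability under sech^2 bounds *)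

Section square_integrable.
Context {R : realType}.
Implicit Types (f : R -> R[i]).
Local Notation mu := (@lebesgue_measure R).

Lemma sqr_normc (z : R[i]) :
  normc z ^+ 2 = complex.Re z ^+ 2 + complex.Im z ^+ 2.
Proof. by case: z => a b; rewrite /= sqr_sqrtr// addr_ge0 ?sqr_ge0. Qed.

Lemma normc_ge0 (z : R[i]) : 0 <= normc z.
Proof. by case: z => a b; exact: sqrtr_ge0. Qed.

Lemma integral_FTC (F f : R -> R) (a b : R) :
  (forall x : R, is_derive x 1 F (f x)) -> continuous f -> a <= b ->
  (\int[mu]_(x in `[a, b]) (f x)%:E = (F b - F a)%:E)%E.
Proof.
move=> dF cf; rewrite le_eqVlt => /predU1P[->|ab].
  by rewrite set_itv1 integral_set1 subrr.
have cF : continuous F.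
  by move=> x; apply/differentiable_continuous/derivable1_diffP; case: (dF x).
rewrite (continuous_FTC2 (F := F) ab) ?EFinB//.
- exact: continuous_subspaceT.
- split; first by move=> x _; case: (dF x).
  + exact/cvg_at_right_filter/cF.
  + exact/cvg_at_left_filter/cF.
- by move=> x _; rewrite derive1E; case: (dF x).
Qed.

Lemma continuous_tanh : continuous (@tanh R).
Proof.
by move=> x; apply/differentiable_continuous/derivable1_diffP; case: (der_tanh x).
Qed.

Lemma continuous_sech2 : continuous (fun x : R => 1 - tanh x ^+ 2).
Proof.
apply: smooth_continuous; apply: smoothD; first exact: smooth_cst.
apply: smoothN; apply: smoothX; apply: smooth_tanh; exact: smooth_id.
Qed.

(** tanh is a primitive of sech^2 and runs from 0 to 1 on the half-line. *)
Lemma integral_sech2 : (\int[mu]_x (1 - tanh x ^+ 2)%:E = 2%:E)%E.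
Proof.
rewrite ge0_symfun_integralT.
- rewrite -set_itvcy (@ge0_continuous_FTC2y _ _ tanh 0 1).
  + by rewrite /tanh /sinh oppr0 subrr !mul0r sube0 mule1.
  + by move=> x _; rewrite ltW// sech2_gt0.
  + exact: continuous_subspaceT continuous_sech2.
  + exact: cvg_tanh_pinfty.
  + by move=> x _; case: (der_tanh x).
  + exact/cvg_at_right_filter/continuous_tanh.
  + by move=> x _; rewrite derive1E; case: (der_tanh x).
- by move=> x; rewrite ltW// sech2_gt0.
- exact: continuous_sech2.
- by move=> x /=; rewrite tanhN sqrrN.
Qed.

Lemma measurable_sqr_normc f (D : set R) : cmeasurable f ->
  measurable_fun D (EFin \o (fun x => normc (f x) ^+ 2 : R)).
Proof.
move=> [mr mi]; apply: measurable_funTS; apply/measurable_EFinP.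
under eq_fun do rewrite sqr_normc.
by apply: measurable_funD; apply: measurable_funX.
Qed.

Lemma integral_le_sech2 (g : R -> R) (C : R) : 0 <= C ->
  measurable_fun [set: R] g -> (forall x, 0 <= g x <= C * (1 - tanh x ^+ 2)) ->
  (\int[mu]_x (g x)%:E <= (2 * C)%:E)%E.
Proof.
move=> C0 mg gC.
have ms : measurable_fun [set: R] (EFin \o (fun x : R => 1 - tanh x ^+ 2 : R)).
  by apply/measurable_EFinP; exact: (continuous_measurable_fun continuous_sech2).
rewrite mulrC EFinM -integral_sech2 -ge0_integralZl_EFin//; last first.
  by move=> x _; rewrite lee_fin ltW// sech2_gt0.
apply: ge0_le_integral => //.
- by move=> x _; rewrite lee_fin; case/andP: (gC x).
- exact/measurable_EFinP.
- exact: measurable_funeM.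
- by move=> x _; rewrite -EFinM lee_fin; case/andP: (gC x).
Qed.

Lemma Lpnorm2E f :
  (Lpnorm 2%:E f ^+ 2 = \int[mu]_x (normc (f x) ^+ 2)%:E)%E.
Proof.
rewrite /Lpnorm unlock poweR12_sqrt; last by apply: integral_ge0 => x _; exact: poweR_ge0.
rewrite sqr_sqrte; last by apply: integral_ge0 => x _; exact: poweR_ge0.
apply: eq_integral => x _.
rewrite gee0_abs ?lee_fin ?normc_ge0// poweR_EFin; congr _%:E.
by rewrite powR_mulrn// normc_ge0.
Qed.

(** Every term of the H^2_- norm is estimated through the majorant sech^2. *)
Lemma Lpnorm2_le f (C : R) : 0 <= C -> cmeasurable f ->
  (forall x, normc (f x) ^+ 2 <= C * (1 - tanh x ^+ 2)) ->
  in_Lp 2%:E f /\ (Lpnorm 2%:E f ^+ 2 <= (2 * C)%:E)%E.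
Proof.
move=> C0 mf fC.
have le : (Lpnorm 2%:E f ^+ 2 <= (2 * C)%:E)%E.
  rewrite Lpnorm2E; apply: integral_le_sech2 => //.
    exact: (measurable_EFinP _ _).1 (measurable_sqr_normc mf).
  by move=> x; rewrite sqr_ge0 fC.
split=> //; split=> //.
have : (0 <= Lpnorm 2%:E f)%E by exact: Lnorm_ge0.
by move: le; case: (Lpnorm _ _) => [r||]//; rewrite ?ltry.
Qed.

Lemma in_L2loc_bounded f (B : R) : cmeasurable f ->
  (forall x, normc (f x) ^+ 2 <= B) -> in_L2loc f.
Proof.
move=> mf fB; split=> // K cK; have mK := compact_measurable cK.
apply: (@le_lt_trans _ _ (\int[mu]_(x in K) (cst B%:E) x)%E).
  apply: ge0_le_integral => //.
  - by move=> x _; rewrite lee_fin sqr_ge0.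
  - exact: measurable_sqr_normc.
  - by move=> x _; rewrite lee_fin.
rewrite integral_cst//.
apply: lte_mul_pinfty => //; last exact: compact_finite_measure.
by rewrite lee_fin (le_trans _ (fB 0))// sqr_ge0.
Qed.

Lemma in_Linfty_bounded f : cmeasurable f -> (forall x, normc (f x) < 1) ->
  in_Lp +oo%E f.
Proof.
move=> mf f1; split=> //; rewrite /Lpnorm unlock /=; case: ifPn => // _.
apply: (@le_lt_trans _ _ 1%E); last by rewrite ltry.
apply/ess_supP; apply: nearW => x /=.
by rewrite lee_fin ger0_norm ?normc_ge0// ltW.
Qed.

Lemma cderiveE (a b a' b' : R -> R) :
  (forall x : R, is_derive x 1 a (a' x)) -> (forall x : R, is_derive x 1 b (b' x)) ->
  cderive (fun x => a x +i* b x) = fun x => a' x +i* b' x.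
Proof.
move=> da db; apply/funext => x; rewrite /cderive /= !derive1E.
by congr (_ +i* _); [case: (da x)|case: (db x)].
Qed.

End square_integrable.

(** * The dark soliton *)

Definition soliton {R : realType} (c x : R) : R[i] :=
  re0 (kappa c) (tanh x) +i* im0 (kappa c) (tanh x).

(* [smooth_tanh] comes before the algebraic rules, which would otherwise unify
   with the definition of tanh as a quotient. *)
Ltac prove_smooth := repeat first
  [ assumption | exact: smooth_cst | exact: smooth_id | exact: smooth_fst
  | exact: smooth_snd | apply: smooth_tanh | apply: smoothD
  | apply: smoothN | apply: smoothX | apply: smoothM | apply: smoothV ].

Section smoothness.
Context {R : realType} {V : normedModType R}.
Implicit Types (k t : V -> R).

Lemma smooth_re0 k t : smooth_fun k -> smooth_fun t ->
  smooth_fun (fun p => re0 (k p) (t p)).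
Proof.
move=> Ck Ct; rewrite /re0; apply: smoothM; first by prove_smooth.
by apply: smoothV => [p|]; [exact: denom_neq0|rewrite /denom; prove_smooth].
Qed.

Lemma smooth_im0 k t : smooth_fun k -> smooth_fun t ->
  smooth_fun (fun p => im0 (k p) (t p)).
Proof.
move=> Ck Ct; rewrite /im0; apply: smoothM; first by prove_smooth.
by apply: smoothV => [p|]; [exact: denom_neq0|rewrite /denom; prove_smooth].
Qed.

Lemma smooth_re1 k t : smooth_fun k -> smooth_fun t ->
  smooth_fun (fun p => re1 (k p) (t p)).
Proof.
move=> Ck Ct; rewrite /re1; apply: smoothM; first by prove_smooth.
apply: smoothV => [p|]; first by rewrite expf_neq0// denom_neq0.
by rewrite /denom; prove_smooth.
Qed.

Lemma smooth_im1 k t : smooth_fun k -> smooth_fun t ->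
  smooth_fun (fun p => im1 (k p) (t p)).
Proof.
move=> Ck Ct; rewrite /im1; apply: smoothM; first by prove_smooth.
apply: smoothV => [p|]; first by rewrite expf_neq0// denom_neq0.
by rewrite /denom; prove_smooth.
Qed.

Lemma smooth_re2 k t : smooth_fun k -> smooth_fun t ->
  smooth_fun (fun p => re2 (k p) (t p)).
Proof.
move=> Ck Ct; rewrite /re2; apply: smoothM; first by prove_smooth.
apply: smoothV => [p|]; first by rewrite expf_neq0// denom_neq0.
by rewrite /denom; prove_smooth.
Qed.

Lemma smooth_im2 k t : smooth_fun k -> smooth_fun t ->
  smooth_fun (fun p => im2 (k p) (t p)).
Proof.
move=> Ck Ct; rewrite /im2; apply: smoothM; first by prove_smooth.
apply: smoothV => [p|]; first by rewrite expf_neq0// denom_neq0.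
by rewrite /denom; prove_smooth.
Qed.

Lemma smooth_kappa (c : V -> R) : smooth_fun c -> smooth_fun (fun p => kappa (c p)).
Proof.
move=> Cc; apply: smoothM => //; apply: smoothV => [p|]; first exact: kappa_denom_neq0.
apply: smoothD; first exact: smooth_cst.
by apply: smooth_sqrt => [p|]; [exact: onePsqr_gt0|prove_smooth].
Qed.

End smoothness.

Section soliton_properties.
Context {R : realType}.
Implicit Types (c x : R).

Lemma soliton0 : soliton (0 : R) = black_soliton.
Proof.
apply/funext => x; rewrite /soliton /black_soliton kappa0 /re0 /im0 /denom.
by rewrite expr0n/= subr0 !mul0r addr0 mul1r divr1.
Qed.

Lemma smooth_tanhx : smooth_fun (fun x : R => tanh x).
Proof. by prove_smooth. Qed.

Lemma smooth_soliton c : smooth [set: R] (soliton c).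
Proof.
by move=> n; split; [apply: smooth_re0|apply: smooth_im0];
  [exact: smooth_cst|exact: smooth_tanhx|exact: smooth_cst|exact: smooth_tanhx].
Qed.

Lemma smooth_soliton_family (D : set (R * R)) :
  smooth D (fun p => soliton p.1 p.2).
Proof.
move=> n; have Ck := smooth_kappa (@smooth_fst R).
have Ct := smooth_tanh (@smooth_snd R).
by split; apply: class_C_sub; [exact: smooth_re0|exact: smooth_im0].
Qed.

Lemma cderive_soliton c : cderive (soliton c) =
  fun x => re1 (kappa c) (tanh x) +i* im1 (kappa c) (tanh x).
Proof. by apply: cderiveE => x; [exact: der_re0|exact: der_im0]. Qed.

Lemma cderive2_soliton c : cderive (cderive (soliton c)) =
  fun x => re2 (kappa c) (tanh x) +i* im2 (kappa c) (tanh x).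
Proof.
by rewrite cderive_soliton; apply: cderiveE => x; [exact: der_re1|exact: der_im1].
Qed.

Lemma profile_eq_soliton c : profile_eq c (soliton c).
Proof.
move=> x; rewrite /profile_eq cderive2_soliton cderive_soliton sqr_normc.
have /= := profile_re (tanh x) (kappaE c); have /= := profile_im (tanh x) (kappaE c).
rewrite /soliton /=; set eta := 1 - _; move=> him hre.
apply/eqP; rewrite eq_complex /=; apply/andP; split; apply/eqP.
  by rewrite -[RHS]hre; ring.
by rewrite -[RHS]him; ring.
Qed.

Lemma sqr_normc_soliton_lt1 c x : normc (soliton c x) ^+ 2 < 1.
Proof.
rewrite sqr_normc /= -subr_gt0 modulus_profile divr_gt0//.
  by rewrite mulr_gt0 ?sech2_gt0// subr_gt0 kappa_sqr_lt1.
by rewrite (lt_le_trans ltr01)// denom_ge1.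
Qed.

Lemma cmeasurable_smooth (f : R -> R[i]) :
  smooth_fun (fun x => complex.Re (f x)) -> smooth_fun (fun x => complex.Im (f x)) ->
  cmeasurable f.
Proof.
by move=> Cr Ci; split; apply: continuous_measurable_fun; exact: smooth_continuous.
Qed.

(** In terms of t = tanh x the profile is continuous on the whole line, and it
    sends the limits t = 1 and t = -1 to the unit circle. *)
Lemma soliton_at_infinity c (L : R) (F : set_system R) : Filter F ->
  L ^+ 2 = 1 -> tanh x @[x --> F] --> L ->
  normc (soliton c x) @[x --> F] --> (1 : R) /\
  exists theta : R, cvg_phase (soliton c) F theta.
Proof.
move=> FF L1 FL; pose k := kappa c.
have ab1 : re0 k L ^+ 2 + im0 k L ^+ 2 = 1.
  apply/esym/eqP; rewrite -subr_eq0 modulus_profile L1 subrr mulr0 mul0r//.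
have lim (a b : R) : (normc ((re0 k (tanh x) - a) +i* (im0 k (tanh x) - b))) @[x --> F]
    --> normc ((re0 k L - a) +i* (im0 k L - b)).
  have cn : continuous (fun t : R => normc ((re0 k t - a) +i* (im0 k t - b))).
    move=> t; apply: continuous_comp; last exact: sqrt_continuous.
    apply: smooth_continuous; apply: smoothD; apply: smoothX; apply: smoothD;
      try exact: smooth_cst.
    + by apply: smooth_re0; prove_smooth.
    + by apply: smooth_im0; prove_smooth.
  by have := continuous_cvg _ (cn L) FL; apply.
split.
  have := lim 0 0; rewrite /= !subr0 ab1 sqrtr1.
  by under eq_fun do rewrite !subr0.
have [t [t0 t2 ct st]] := unit_circle_phase ab1.
exists t; split=> //; rewrite /cis ct st.
have := lim (re0 k L) (im0 k L); rewrite /= !subrr expr0n/= addr0 sqrtr0.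
by apply.
Qed.

Lemma cvg_tanh_ninfty : tanh x @[x --> -oo] --> (-1 : R).
Proof.
apply/cvgNy_compNP; under eq_fun do rewrite /= tanhN.
exact: cvgN cvg_tanh_pinfty.
Qed.

Lemma in_F_soliton c : in_F (soliton c).
Proof.
have lt1 x : normc (soliton c x) < 1.
  by rewrite -(@expr_lt1 _ 2)// ?normc_ge0// sqr_normc_soliton_lt1.
split=> //.
- apply: in_Linfty_bounded => //; apply: cmeasurable_smooth => n;
  by have [] := smooth_soliton c n.
- by have [] := soliton_at_infinity c _ (expr1n _ _) cvg_tanh_pinfty.
- by have [] := soliton_at_infinity c _ (etrans (sqrrN _) (expr1n _ _)) cvg_tanh_ninfty.
Qed.

Lemma smooth_cosh : smooth_fun (@cosh R).
Proof.
apply: smoothM; last exact: smooth_cst.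
by apply: smoothD; apply: smooth_expR; prove_smooth.
Qed.

Lemma smooth_sqrt_sech2 : smooth_fun (fun x : R => Num.sqrt (1 - tanh x ^+ 2)).
Proof. by apply: smooth_sqrt => [x|]; [exact: sech2_gt0|prove_smooth]. Qed.

Lemma cmeasurableZ (r : R -> R) (f : R -> R[i]) : smooth_fun r -> cmeasurable f ->
  cmeasurable (fun x => (r x)%:C * f x).
Proof.
move=> /smooth_continuous/continuous_measurable_fun mr [fr fi].
split; [rewrite (_ : (fun x => _) = fun x => r x * complex.Re (f x))|
        rewrite (_ : (fun x => _) = fun x => r x * complex.Im (f x))];
  try exact: measurable_funM.
- by apply/funext => x; case: (f x) => a b /=; ring.
- by apply/funext => x; case: (f x) => a b /=; ring.
Qed.

Lemma sqr_normcZ (r : R) (z : R[i]) : normc (r%:C * z) ^+ 2 = r ^+ 2 * normc z ^+ 2.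
Proof. by case: z => a b; rewrite !sqr_normc /=; ring. Qed.

(** ** The distance to the black soliton *)

Section difference.
Variable c : R.
Let k := kappa c.
Let k1 : k ^+ 2 <= 1. Proof. exact: ltW (kappa_sqr_lt1 c). Qed.

Let g x := soliton c x - black_soliton x.

Let gE : g = fun x => (re0 k (tanh x) - tanh x) +i* im0 k (tanh x).
Proof. by apply/funext => x; congr (_ +i* _); rewrite subr0. Qed.

Let der_dre0 x :
  is_derive x 1 (fun y => re0 k (tanh y) - tanh y) (re1 k (tanh x) - (1 - tanh x ^+ 2)).
Proof. exact: derD (der_re0 k x) (derN (der_tanh x)). Qed.

Let der_dre1 x :
  is_derive x 1 (fun y => re1 k (tanh y) - (1 - tanh y ^+ 2))
    (re2 k (tanh x) + 2 * tanh x * (1 - tanh x ^+ 2)).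
Proof.
have := derD (der_re1 k x) (derN (derD (der_cst x 1) (derN (derX 2 (der_tanh x))))).
by move=> d; notypeclasses refine (is_derive_eq d _); rewrite /=; ring.
Qed.

Let dgE : cderive g =
  fun x => (re1 k (tanh x) - (1 - tanh x ^+ 2)) +i* im1 k (tanh x).
Proof. rewrite gE; exact: cderiveE der_dre0 (der_im0 k). Qed.

Let ddgE : cderive (cderive g) =
  fun x => (re2 k (tanh x) + 2 * tanh x * (1 - tanh x ^+ 2)) +i* im2 k (tanh x).
Proof. rewrite dgE; exact: cderiveE der_dre1 (der_im1 k). Qed.

Let Ck : smooth_fun (fun _ : R => k). Proof. exact: smooth_cst. Qed.
Let Ct := smooth_tanhx.

Let mg : cmeasurable g.
Proof.
rewrite gE; apply: cmeasurable_smooth => /=; last exact: smooth_im0.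
by apply: smoothD; [exact: smooth_re0|prove_smooth].
Qed.

Let mdg : cmeasurable (cderive g).
Proof.
rewrite dgE; apply: cmeasurable_smooth => /=; last exact: smooth_im1.
by apply: smoothD; [exact: smooth_re1|prove_smooth].
Qed.

Let smooth_ddre :
  smooth_fun (fun x => re2 k (tanh x) + 2 * tanh x * (1 - tanh x ^+ 2)).
Proof. by apply: smoothD; [exact: smooth_re2|prove_smooth]. Qed.

Let smooth_ddim : smooth_fun (fun x => im2 k (tanh x)).
Proof. exact: smooth_im2. Qed.

Let g_le x : normc (g x) ^+ 2 <= 4 * k ^+ 2.
Proof. by rewrite gE sqr_normc; exact: re0_im0_near (tanh_sqr_le1 x). Qed.

Let Wg_le x : (1 - tanh x ^+ 2) * normc (g x) ^+ 2 <= 4 * k ^+ 2 * (1 - tanh x ^+ 2).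
Proof. by rewrite mulrC ler_wpM2r// ltW// sech2_gt0. Qed.

Let dg_le x : normc (cderive g x) ^+ 2 <= 20 * k ^+ 2 * (1 - tanh x ^+ 2).
Proof. by rewrite dgE sqr_normc; exact: re1_im1_near k1 (tanh_sqr_le1 x). Qed.

Let ddg_le x : normc ((cosh x)%:C * cderive (cderive g) x) ^+ 2 <=
  1664 * k ^+ 2 * (1 - tanh x ^+ 2).
Proof.
have c2 : 0 < cosh x ^+ 2 by rewrite exprn_gt0// cosh_gt0.
rewrite sqr_normcZ ddgE sqr_normc.
rewrite -ler_pdivlMl//.
apply: le_trans (re2_im2_near k1 (tanh_sqr_le1 x)) _.
by rewrite -sech2E [leRHS]mulrC -[leRHS]mulrA.
Qed.

Let mddg : cmeasurable (fun x => (cosh x)%:C * cderive (cderive g) x).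
Proof.
apply: cmeasurableZ smooth_cosh _.
by rewrite ddgE; apply: cmeasurable_smooth.
Qed.

Let ck (n : nat) : 0 <= n%:R * k ^+ 2.
Proof. by rewrite mulr_ge0// ?sqr_ge0// ler0n. Qed.

Lemma in_Hm2_soliton : in_Hm2 g.
Proof.
split.
- split; first exact: in_L2loc_bounded mg g_le.
  have [] // := @Lpnorm2_le R (fun x => (Num.sqrt (1 - tanh x ^+ 2))%:C * g x) (4 * k ^+ 2).
  + exact: cmeasurableZ smooth_sqrt_sech2 mg.
  + by move=> x; rewrite sqr_normcZ sqr_sqrtr// ltW// sech2_gt0.
- split; first by have [] := Lpnorm2_le (ck 20) mdg dg_le.
  by have [] := Lpnorm2_le (ck 1664) mddg ddg_le.
- move=> x; rewrite gE /=; split; first by case: (der_dre0 x).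
  by case: (der_im0 k x).
- move=> a b ab; rewrite ddgE dgE /=; split.
  + exact: integral_FTC der_dre1 (smooth_continuous smooth_ddre) ab.
  + exact: integral_FTC (der_im1 k) (smooth_continuous smooth_ddim) ab.
Qed.

(** The three squared terms of the norm add up to at most
    2 (1664 + 20 + 4) k^2 <= 3600 c^2. *)
Lemma Hm2_norm_soliton_le : (Hm2_norm g <= (60 * `|c|)%:E)%E.
Proof.
have [_ h2] := Lpnorm2_le (ck 1664) mddg ddg_le.
have [_ h1] := Lpnorm2_le (ck 20) mdg dg_le.
have h0 : (H_norm g ^+ 2 <= (2 * (4 * k ^+ 2))%:E)%E.
  rewrite sqr_sqrte; last first.
    by apply: integral_ge0 => x _; rewrite lee_fin mulr_ge0 ?sqr_ge0// ltW// sech2_gt0.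
  apply: integral_le_sech2 => //.
    apply: measurable_funM; last exact: (measurable_EFinP _ _).1 (measurable_sqr_normc mg).
    exact: (continuous_measurable_fun continuous_sech2).
  by move=> x; rewrite Wg_le mulr_ge0 ?sqr_ge0// ltW// sech2_gt0.
apply: (@le_trans _ _ (sqrte ((60 * `|c|) ^+ 2)%:E)).
  rewrite lee_sqrt ?lee_fin ?sqr_ge0//.
  apply: le_trans (leeD (leeD h2 h1) h0) _; rewrite -!EFinD lee_fin.
  have -> : (60 * `|c|) ^+ 2 = 60 ^+ 2 * c ^+ 2.
    by rewrite exprMn real_normK// num_real.
  have := kappa_sqr_le c; rewrite -/k.
  by move: (k ^+ 2) (c ^+ 2) (sqr_ge0 k) => a b; lra.
by rewrite /= sqrtr_sqr ger0_norm// mulr_ge0.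
Qed.

End difference.
End soliton_properties.

Theorem theorem2 (R : realType) :
  exists U : R -> R -> R[i],
    [/\ forall c : R,
          [/\ in_F (U c),
              smooth [set: R] (U c),
              profile_eq c (U c),
              exists theta_p : R, cvg_phase (U c) (+oo%R) theta_p
            & exists theta_m : R, cvg_phase (U c) (-oo%R) theta_m],
        U 0 = black_soliton,
        smooth [set p : (R * R)%type | p.1 != 0] (fun p => U p.1 p.2),
        forall c : R, in_Hm2 (fun x => U c x - black_soliton x)
      & Hm2_norm (fun x => U c x - black_soliton x) @[c --> (0 : R)^']
          --> 0%E].
Proof.
exists soliton; split.
- move=> c; split.
  + exact: in_F_soliton.
  + exact: smooth_soliton.
  + exact: profile_eq_soliton.
  + by have [] := soliton_at_infinity c _ (expr1n _ _) cvg_tanh_pinfty.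
  + by have [] := soliton_at_infinity c _ (etrans (sqrrN _) (expr1n _ _)) cvg_tanh_ninfty.
- exact: soliton0.
- exact: smooth_soliton_family.
- exact: in_Hm2_soliton.
apply: (@squeeze_cvge _ _ _ _ (cst 0%E) _ (fun c => (60 * `|c|)%:E)).
- by apply: nearW => c; rewrite sqrte_ge0 Hm2_norm_soliton_le.
- exact: cvg_cst.
apply/cvg_EFin; first by apply: nearW.
have h : 60 * `|c| @[c --> (0 : R)] --> 60 * `|0 : R|.
  by apply: cvgM; [exact: cvg_cst|exact: norm_continuous].
by rewrite normr0 mulr0 in h; exact: cvg_within_filter h.
Qed.
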